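(* Let $\rho\in(0,\varepsilon/2)$. Let the data-generating distribution $\mathbb{P}_0$ of $(\tilde\xi_1,\tilde\xi_2)$ be the two-point distribution with $\mathbb{P}_0[(\tilde\xi_1,\tilde\xi_2)=(1,1)]=\rho$ and $\mathbb{P}_0[(\tilde\xi_1,\tilde\xi_2)=(-1,1)]=1-\rho$. Consider the distributionally robust chance constrained program $$(\star)\qquad\inf_{x\in\mathbb{R}}\; -x\quad\text{s.t.}\quad \mathbb{P}[x>\tilde\xi_1,\;x<\tilde\xi_2]\ge 1-\varepsilon\;\;\forall\mathbb{P}\in\mathcal{F}(\theta),\quad 0\le x\le 1.$$ Then, as $N\to\infty$, with probability going to $1$, we have that (i) the worst-case CVaR approximation to $(\star)$ that replaces the joint chance constraint with $$\sup_{\mathbb{P}\in\mathcal{F}(\theta)}\mathbb{P}\text{-CVaR}_\varepsilon\big(\max\{w_1(\tilde\xi_1-x),\,w_2(x-\tilde\xi_2)\}\big)\le 0$$ becomes exact (that is, its optimal value equals the optimal value of $(\star)$) if the scaling factors $(w_1,w_2)$ are $(\frac12,\frac12)$; (ii) the ALSO-X approximation to $(\star)$ becomes infeasible.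
   Context: Risk threshold $\varepsilon\in(0,1)$. The samples $\hat{\boldsymbol{\xi}}_1,\dots,\hat{\boldsymbol{\xi}}_N\in\mathbb{R}^2$ are drawn independently from $\mathbb{P}_0$; ''with probability going to $1$'' refers to the sampling. $\hat{\mathbb{P}}=\frac1N\sum_{i=1}^N\delta_{\hat{\boldsymbol{\xi}}_i}$ is the empirical distribution and $\mathcal{F}(\theta)=\{\mathbb{P}\in\mathcal{P}(\mathbb{R}^2) : d_{\rm W}(\mathbb{P},\hat{\mathbb{P}})\le\theta\}$, where $\mathcal{P}(\mathbb{R}^2)$ is the set of probability distributions on $\mathbb{R}^2$ and $d_{\rm W}(\mathbb{P}_1,\mathbb{P}_2)$ is the type-1 Wasserstein distance (infimum of $\mathbb{E}[\|\tilde{\boldsymbol{\xi}}-\tilde{\boldsymbol{\xi}}'\|]$ over all joint distributions with marginals $\mathbb{P}_1,\mathbb{P}_2$) for a $p$-norm $\|\cdot\|$ with $p\in\mathbb{Q}$, $p>1$. The radius $\theta=\theta_N\ge0$ depends on $N$ and decays to zero as $N\to\infty$, and it is assumed that in the limit $N\to\infty$ the set $\mathcal{F}(\theta_N)$ contains $\mathbb{P}_0$ with probability one. $\mathbb{P}\text{-CVaR}_\varepsilon(\ell(\tilde{\boldsymbol{\xi}}))=\inf\{\tau+\mathbb{E}_{\mathbb{P}}[(\ell(\tilde{\boldsymbol{\xi}})-\tau)^+]/\varepsilon : \tau\in\mathbb{R}\}$ with $(y)^+=\max\{y,0\}$. ALSO-X approximation: for a problem minimizing $c\,x$ over $x\in\mathcal{X}$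 subject to $\sup_{\mathbb{P}\in\mathcal{F}(\theta)}\mathbb{P}[g(x,\tilde{\boldsymbol{\xi}})\ge0]\le\varepsilon$, let, for each $\delta$ for which the following problem is feasible, $x^\star(\delta)$ be an (arbitrarily chosen) minimizer of $\sup_{\mathbb{P}\in\mathcal{F}(\theta)}\mathbb{E}_{\mathbb{P}}[(g(x,\tilde{\boldsymbol{\xi}}))^+]$ over $\{x\in\mathcal{X} : c\,x\le\delta\}$. ALSO-X determines the smallest $\delta$ for which $x^\star(\delta)$ satisfies $\sup_{\mathbb{P}\in\mathcal{F}(\theta)}\mathbb{P}[g(x^\star(\delta),\tilde{\boldsymbol{\xi}})\ge0]\le\varepsilon$ and returns the corresponding $x^\star(\delta)$; it is infeasible if no $\delta$ yields an $x^\star(\delta)$ satisfying this constraint. For $(\star)$, $\mathcal{X}=[0,1]$, $c=-1$ and $g(x,\boldsymbol{\xi})=\max\{\xi_1-x,\,x-\xi_2\}$.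
   Formalization: In (i), ''becomes exact'' is stated asymptotically: for every η>0, with probability going to 1, the two optimal values differ by at most η. Exact equality at finite N fails: the values are -(1-θ/(ε-2r)) and -(1-θ/(ε-r)), r>0 being the empirical mass of (1,1), θ>0 small. *)

(* Defs.v *)
(* MathComp-Analysis, over an arbitrary realType. *)
From HB Require Import structures.
From mathcomp Require Import all_boot all_order all_algebra.
From mathcomp Require Import all_classical all_reals all_analysis.
Import Order.TTheory GRing.Theory Num.Theory.
Import numFieldNormedType.Exports.

Set Implicit Arguments.
Unset Strict Implicit.
Unset Printing Implicit Defensive.

Local Open Scope classical_set_scope.
Local Open Scope ring_scope.

Section sampling.
Context d (Omega : measurableType d) (R : realType) (Pr : probability Omega R).

(* The events of interest need not be measurable (they involve suprema over
   sets of distributions), so the probabilities that must converge to 1 are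
   those of measurable sub-events; for measurable events E this says exactly
   that Pr (E N) --> 1. *)
Definition with_probability_going_to_1 (E : nat -> set Omega) : Prop :=
  exists A : nat -> set Omega,
    [/\ forall N, measurable (A N),
        forall N, A N `<=` E N &
        Pr (A N) @[N --> \oo] --> 1%E].

Definition mutually_independent d' (T : measurableType d')
    (X : nat -> {RV Pr >-> T}) : Prop :=
  forall (J : seq nat) (B : nat -> set T), uniq J ->
    (forall i, measurable (B i)) ->
    Pr (\bigcap_(i in [set` J]) (X i @^-1` B i))
      = (\prod_(i <- J) Pr (X i @^-1` B i))%E.

Definition iid_samples d' (T : measurableType d') (P0 : probability T R)
    (X : nat -> {RV Pr >-> T}) : Prop :=
  mutually_independent X /\
  forall i B, measurable B -> distribution Pr (X i) B = P0 B.

End sampling.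

(* The empirical distribution of x_0, ..., x_n, i.e. of the first N = n + 1
   terms of the sequence x; this indexing makes N >= 1 automatic. *)
Section empirical_distribution.
Context d (T : measurableType d) (R : realType).
Variables (x : nat -> T) (n : nat).

Definition empirical : set T -> \bar R :=
  mscale ((n.+1%:R : R)^-1)%:nng (msum (fun i => \d_(x i)) n.+1).

HB.instance Definition _ := Measure.on empirical.

Let empirical_setT : empirical [set: T] = 1%E.
Proof.
rewrite /empirical /mscale /= /msum.
under eq_bigr do rewrite /= diracT.
rewrite sumEFin sumr_const card_ord -EFinM.
by rewrite mulVf // pnatr_eq0.
Qed.

HB.instance Definition _ :=
  Measure_isProbability.Build _ _ _ empirical empirical_setT.

End empirical_distribution.
Arguments empirical {d T} R x n.

Section wasserstein.
Variable R : realType.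

Definition pnorm (p : R) (v : R * R) : R :=
  (`|v.1| `^ p + `|v.2| `^ p) `^ p^-1.

Definition coupling (P1 P2 : probability (R * R)%type R)
    (gamma : probability ((R * R) * (R * R))%type R) : Prop :=
  forall B : set (R * R), measurable B ->
    gamma (fst @^-1` B) = P1 B /\ gamma (snd @^-1` B) = P2 B.

Definition wasserstein (p : R) (P1 P2 : probability (R * R)%type R) : \bar R :=
  ereal_inf [set (\int[gamma]_z (pnorm p (z.1 - z.2))%:E)%E
            | gamma in coupling P1 P2].

Definition wasserstein_ball (p theta : R) (Phat : probability (R * R)%type R) :
    set (probability (R * R)%type R) :=
  [set P | (wasserstein p P Phat <= theta%:E)%E].

End wasserstein.

Section chance_constraints.
Variable R : realType.
Local Notation law := (probability (R * R)%type R).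

Definition cvar (eps : R) (P : law) (l : R * R -> R) : \bar R :=
  ereal_inf [set (tau%:E +
                  'E_P[fun xi => Num.max (l xi - tau)%R 0%R] * (eps^-1)%:E)%E
            | tau in [set: R]].

(* The optimal value of inf c x over the feasible set S; it is +oo when S is
   empty. *)
Definition optimal_value (c : R) (S : set R) : \bar R :=
  ereal_inf [set (c * x)%:E | x in S].

Definition star_domain : set R := [set x | 0 <= x <= 1].

Definition star_function (x : R) (xi : R * R) : R :=
  Num.max (xi.1 - x) (x - xi.2).

Definition star_feasible (F : set law) (eps : R) : set R :=
  [set x | star_domain x /\
    forall P, F P ->
      ((1 - eps)%:E <= P [set xi | (x > xi.1)%R && (x < xi.2)%R])%E].

Definition star_value (F : set law) (eps : R) : \bar R :=
  optimal_value (-1) (star_feasible F eps).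

Definition scaled_loss (w1 w2 x : R) (xi : R * R) : R :=
  Num.max (w1 * (xi.1 - x)) (w2 * (x - xi.2)).

Definition worst_case_cvar (F : set law) (eps : R) (l : R * R -> R) : \bar R :=
  ereal_sup [set cvar eps P l | P in F].

Definition cvar_feasible (F : set law) (eps w1 w2 : R) : set R :=
  [set x | star_domain x /\
    (worst_case_cvar F eps (scaled_loss w1 w2 x) <= 0)%E].

Definition cvar_value (F : set law) (eps w1 w2 : R) : \bar R :=
  optimal_value (-1) (cvar_feasible F eps w1 w2).

(* ALSO-X for: minimize c x over x in X subject to
   sup_(P in F) P [g x >= 0] <= eps. *)
Section alsox.
Variables (F : set law) (eps : R).
Variables (X : set R) (c : R) (g : R -> R * R -> R).

Definition worst_case_hinge (x : R) : \bar R :=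
  ereal_sup [set 'E_P[fun xi => Num.max (g x xi) 0%R]%E | P in F].

Definition worst_case_violation (x : R) : \bar R :=
  ereal_sup [set P [set xi | 0 <= g x xi] | P in F].

Definition alsox_domain (delta : R) : set R := [set x | X x /\ c * x <= delta].

(* xs delta is an arbitrary value when the domain at delta is empty. *)
Definition alsox_selection (xs : R -> R) : Prop :=
  forall delta, alsox_domain delta !=set0 ->
    alsox_domain delta (xs delta) /\
    forall y, alsox_domain delta y ->
      (worst_case_hinge (xs delta) <= worst_case_hinge y)%E.

(* The first conjunct (the minimizers x*(delta) exist) excludes vacuous
   infeasibility; the second one holds however the minimizers are chosen. *)
Definition alsox_infeasible : Prop :=
  (exists xs, alsox_selection xs) /\
  forall xs, alsox_selection xs ->
    forall delta, alsox_domain delta !=set0 ->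
      ~ (worst_case_violation (xs delta) <= eps%:E)%E.

End alsox.

End chance_constraints.

(* Main.v *)
Require Import Defs.
From HB Require Import structures.
From mathcomp Require Import all_boot all_order all_algebra.
From mathcomp Require Import all_classical all_reals all_analysis.
From mathcomp Require Import measurable_realfun lra.
Import Order.TTheory GRing.Theory Num.Theory.
Import numFieldNormedType.Exports.

(** Both claims are deterministic consequences of two facts about a sample: the
true law P0 lies in the ball F around the empirical law Phat, and every sample
point is one of the two atoms (1,1), (-1,1). The first holds with probability
going to 1 by assumption, the second almost surely. Membership of P0 in F also
forces the empirical frequencies to be close to the true ones.

The analytic tool is the easy half of Kantorovich duality
([wasserstein_integral]): if f is nonnegative and 1-Lipschitz for the p-norm,
then the integrals of f against two laws at distance at most theta differ by at
most theta. It applies to every hinge max(loss + t, 0), because a p-norm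
dominates each coordinate.

CVaR. Take x = 1 - 2t with t > 0 small. With weights 1/2 the loss is t at the
unsafe atom and -t at the safe one, so the hinge max(loss + t, 0) is 2t with
probability rho and 0 otherwise under P0. Passing from P0 to Phat and then to
any P in F costs theta each time, hence its expectation under P is at most
2 t rho + 2 theta. As rho < eps / 2, this is at most eps t once theta is small.
That single bound makes x feasible twice: tau = -t certifies CVaR <= 0, and
Markov's inequality bounds the probability of violation by eps
([near_one_feasible]). Both optimal values thus lie in [-1, -1 + 2t], for t as
small as desired.

ALSO-X. At x = 1 the hinge vanishes at both atoms, so its worst-case
expectation is at most theta. For x < 1 the hinge is 1 - x at the unsafe atom;
pushing the whole empirical mass r > 0 of that atom by theta / r along the first
axis uses the budget theta exactly, and gives the expectation
r (1 - x) + theta > theta. So x = 1 is the only minimizer, whatever delta is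
([alsox_infeasible_ball]); but at x = 1 both atoms of P0 violate the constraint,
so the violation probability is 1 > eps. *)

Local Open Scope classical_set_scope.
Local Open Scope ring_scope.

(** * Integration *)

Section measures.
Context {R : realType}.

Lemma measurable_point (a : R * R) : measurable [set a].
Proof.
have -> : [set a] = [set a.1] `*` [set a.2].
  apply/seteqP; split => [x -> //|[u v] [/= -> ->]]; by case: a.
by apply: measurableX; exact: measurable_set1.
Qed.

Lemma measurable_pair (a b : R * R) : measurable [set a; b].
Proof. by apply: measurableU; exact: measurable_point. Qed.

(** This covers P0, the empirical law and its perturbation: each integrand taken
against them vanishes at the safe atom [b], so only the mass of the unsafe atom
[a] enters. *)
Lemma integral_two_atoms (Q : probability (R * R)%type R) (f : R * R -> R)
    (a b : R * R) :
  measurable_fun setT f -> (forall x, 0 <= f x) ->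
  Q [set a; b] = 1%E -> f b = 0 ->
  (\int[Q]_x (f x)%:E = (f a)%:E * Q [set a])%E.
Proof.
move=> mf f0 Qab fb.
have m1 : measurable_fun [set: R * R] (fun x => (\1_[set a] x : R)%:E).
  by apply/measurable_EFinP; apply: measurable_indic; exact: measurable_point.
rewrite (@ge0_ae_eq_integral _ _ _ _ _ _
  (fun x => (f a)%:E * (\1_[set a] x)%:E)%E) //.
- rewrite ge0_integralZl_EFin // ?integral_indic //.
  + by rewrite setIT.
  + exact: measurable_point.
- by apply/measurable_EFinP.
- by apply: emeasurable_funM => //; exact: measurable_cst.
- by move=> x _; rewrite lee_fin.
- by move=> x _; rewrite -EFinM lee_fin mulr_ge0.
- have mab := measurable_pair a b.
  have QC : Q (~` [set a; b]) = 0%E by rewrite probability_setC // Qab subee.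
  exists (~` [set a; b]); split => //; first exact: measurableC.
  apply: subsetC => x /= xab _; rewrite indicE.
  case: xab => ->; first by rewrite mem_set //= mule1.
  have [->|ba] := eqVneq b a; first by rewrite mem_set //= mule1.
  by rewrite memNset /= ?mule0 ?fb //; apply/eqP.
Qed.

Lemma le_integral_perturb {d} {T : measurableType d}
    (mu : {measure set T -> \bar R}) (f g c : T -> R) :
  measurable_fun setT f -> measurable_fun setT g -> measurable_fun setT c ->
  (forall x, 0 <= f x) -> (forall x, 0 <= g x) -> (forall x, 0 <= c x) ->
  (forall x, f x <= g x + c x) ->
  (\int[mu]_x (f x)%:E <= \int[mu]_x (g x)%:E + \int[mu]_x (c x)%:E)%E.
Proof.
move=> mf mg mc f0 g0 c0 fgc.
rewrite -ge0_integralD //; try by move=> x _; rewrite lee_fin.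
- apply: ge0_le_integral => //.
  + by move=> x _; rewrite lee_fin.
  + exact/measurable_EFinP.
  + by apply: emeasurable_funD; exact/measurable_EFinP.
  + by move=> x _; rewrite -EFinD lee_fin.
- exact/measurable_EFinP.
- exact/measurable_EFinP.
Qed.

(** The law [nu] is a separate argument, related to [mu] by its values on
measurable sets, since this is how the marginals of a coupling are given. *)
Lemma ge0_integral_image {d1 d2} {T1 : measurableType d1}
    {T2 : measurableType d2} (mu : probability T1 R) (nu : probability T2 R)
    (phi : T1 -> T2) (f : T2 -> R) :
  measurable_fun setT phi ->
  (forall B, measurable B -> mu (phi @^-1` B) = nu B) ->
  measurable_fun setT f -> (forall x, 0 <= f x) ->
  (\int[nu]_x (f x)%:E = \int[mu]_x (f (phi x))%:E)%E.
Proof.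
move=> mphi mu_nu mf f0.
pose phi' : {mfun T1 >-> T2} := mfun_Sub (mem_set mphi).
have := @ge0_integral_distribution _ _ _ _ R mu phi' (EFin \o f).
move=> <-; last 2 first.
- by apply/measurable_EFinP.
- by move=> x; rewrite lee_fin.
by apply: eq_measure_integral => A mA _; exact/esym/mu_nu.
Qed.

Lemma measurable_ge0 {d} {T : measurableType d} (l : T -> R) :
  measurable_fun setT l -> measurable [set x | 0 <= l x].
Proof.
move=> ml; rewrite -[X in measurable X]setTI.
rewrite (_ : [set x | 0 <= l x] = l @^-1` `[0, +oo[%classic).
  exact: ml measurableT _ (measurable_itv _).
by apply/seteqP; split => x /=; rewrite in_itv /= andbT.
Qed.

(** On the event [0 <= l] the hinge is at least [t], so this is Markov's
inequality at level [t]. *)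
Lemma markov_hinge (P : probability (R * R)%type R) (l : R * R -> R) (t e : R) :
  measurable_fun setT l -> 0 < t ->
  (\int[P]_x (Num.max (l x + t)%R 0%R)%:E <= (e * t)%:E)%E ->
  (P [set x | (0 <= l x)%R] <= e%:E)%E.
Proof.
move=> ml t0 hint.
have mA : measurable [set x | 0 <= l x] by exact: measurable_ge0.
rewrite -(@lee_pmul2l _ t%:E) // -EFinM [X in (_ <= X)%E](_ : _ = (e * t)%:E);
  last by rewrite mulrC.
apply: le_trans hint.
rewrite -[X in P X]setIT -integral_indic // -ge0_integralZl_EFin //; last 2 first.
- by apply/measurable_EFinP; apply: measurable_indic.
- exact: ltW.
apply: ge0_le_integral => //.
- by move=> x _; rewrite -EFinM lee_fin mulr_ge0 // ltW.
- by apply: emeasurable_funM => //; apply/measurable_EFinP; apply: measurable_indic.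
- apply/measurable_EFinP; apply: measurable_maxr => //.
  by apply: measurable_funD.
- move=> x _; rewrite -EFinM lee_fin indicE le_max.
  have [|_] := boolP (x \in _); last by rewrite mulr0 lexx orbT.
  by rewrite inE /= mulr1 => lx; rewrite lerDr lx.
Qed.

End measures.

(** * The p-norm and the Wasserstein distance *)

Section pnorm.
Context {R : realType}.
Variable p : R.
Hypothesis p0 : 0 < p.

Lemma pnorm_ge0 v : 0 <= pnorm p v.
Proof. exact: powR_ge0. Qed.

Lemma ler_powRK (a b : R) : 0 <= a -> a `^ p <= b -> a <= b `^ p^-1.
Proof.
move=> a0 ab; rewrite -[leLHS](powRr1 a0) -(mulfV (lt0r_neq0 p0)) powRrM.
apply: ge0_ler_powR => //; rewrite ?invr_ge0 ?nnegrE ?powR_ge0 ?(ltW p0) //.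
exact: le_trans (powR_ge0 _ _) ab.
Qed.

Lemma le_fst_pnorm v : `|v.1| <= pnorm p v.
Proof. by apply: ler_powRK => //; rewrite lerDl powR_ge0. Qed.

Lemma le_snd_pnorm v : `|v.2| <= pnorm p v.
Proof. by apply: ler_powRK => //; rewrite lerDr powR_ge0. Qed.

Lemma pnorm_horizontal c : pnorm p (c, 0) = `|c|.
Proof.
rewrite /pnorm /= normr0 powR0 ?lt0r_neq0 // addr0 -powRrM mulfV ?lt0r_neq0 //.
by rewrite powRr1.
Qed.

Lemma measurable_dist {d} {T : measurableType d} (f g : T -> R * R) :
  measurable_fun setT f -> measurable_fun setT g ->
  measurable_fun setT (fun z => pnorm p (f z - g z)).
Proof.
move=> mf mg.
have mcoord (pr : R * R -> R) : measurable_fun setT pr ->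
    measurable_fun setT (fun z => `|pr (f z) - pr (g z)| `^ p).
  move=> mpr.
  have md : measurable_fun setT (fun z => `|pr (f z) - pr (g z)|).
    apply: measurableT_comp => //; apply: measurable_funB;
      exact: measurableT_comp.
  exact: (measurableT_comp (measurable_powR p) md).
have ms := measurable_funD (mcoord fst measurable_fst) (mcoord snd measurable_snd).
exact: (measurableT_comp (measurable_powR p^-1) ms).
Qed.

Definition nonexpansive (f : R * R -> R) :=
  forall u v, f u <= f v + pnorm p (u - v).

Lemma pnormC u v : pnorm p (u - v) = pnorm p (v - u).
Proof. by rewrite /pnorm -opprB /= !normrN. Qed.

(** For a coupling of cost [c], the Lipschitz bound integrates to a difference of
at most [c]; the infimum defining the distance need not be attained, so couplings
of cost below [theta + e] are used and [e] tends to 0. The cost is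
symmetric, so the same coupling gives both inequalities. *)
Lemma wasserstein_integral (P Q : probability (R * R)%type R) (theta : R)
    (f : R * R -> R) :
  measurable_fun setT f -> (forall x, 0 <= f x) -> nonexpansive f ->
  (wasserstein p P Q <= theta%:E)%E ->
  (\int[P]_x (f x)%:E <= \int[Q]_x (f x)%:E + theta%:E)%E /\
  (\int[Q]_x (f x)%:E <= \int[P]_x (f x)%:E + theta%:E)%E.
Proof.
move=> mf f0 fne W.
suff H e : 0 < e ->
    (\int[P]_x (f x)%:E <= \int[Q]_x (f x)%:E + (theta + e)%:E)%E /\
    (\int[Q]_x (f x)%:E <= \int[P]_x (f x)%:E + (theta + e)%:E)%E.
  split; apply/lee_addgt0Pr => e e0; have [H1 H2] := H e e0;
    by rewrite -addeA -EFinD.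
move=> e0.
have : (wasserstein p P Q < (theta + e)%:E)%E.
  by apply: le_lt_trans W _; rewrite lte_fin ltrDl.
move=> /ereal_inf_lt [_ [gamma cpl <-] /ltW cost].
have [m1 m2] := (@measurable_fst _ _ (R * R)%type (R * R)%type,
                 @measurable_snd _ _ (R * R)%type (R * R)%type).
rewrite (ge0_integral_image gamma P fst) //; last by move=> B /cpl [].
rewrite (ge0_integral_image gamma Q snd) //; last by move=> B /cpl [].
have mc := measurable_dist fst snd m1 m2.
have mf1 : measurable_fun setT (f \o fst) := measurableT_comp mf m1.
have mf2 : measurable_fun setT (f \o snd) := measurableT_comp mf m2.
have c0 (z : (R * R) * (R * R)) : 0 <= pnorm p (z.1 - z.2) by exact: pnorm_ge0.
split; apply: (le_trans _ (leeD2l _ cost)).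
- apply: (le_integral_perturb gamma (f \o fst) (f \o snd)
    (fun z => pnorm p (z.1 - z.2))) => // z.
  + exact: f0.
  + exact: f0.
  + exact: fne.
- apply: (le_integral_perturb gamma (f \o snd) (f \o fst)
    (fun z => pnorm p (z.1 - z.2))) => // z.
  + exact: f0.
  + exact: f0.
  + by rewrite pnormC; exact: fne.
Qed.

(** The law of [s x] is at distance at most the mean displacement, by the coupling
that moves each [x] to [s x]. *)
Lemma image_law (Q : probability (R * R)%type R) (s : R * R -> R * R) :
  measurable_fun setT s ->
  exists P : probability (R * R)%type R,
    (wasserstein p P Q <= \int[Q]_x (pnorm p (s x - x))%:E)%E /\
    forall f : R * R -> R, measurable_fun setT f -> (forall x, 0 <= f x) ->
      (\int[P]_x (f x)%:E = \int[Q]_x (f (s x))%:E)%E.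
Proof.
move=> ms; pose s' : {mfun (R * R)%type >-> (R * R)%type} := mfun_Sub (mem_set ms).
have mg : measurable_fun setT (fun x : R * R => (s x, x)).
  by apply: measurable_fun_pair.
pose g : {mfun (R * R)%type >-> ((R * R) * (R * R))%type} := mfun_Sub (mem_set mg).
exists (distribution Q s'); split; last first.
  by move=> f mf f0; apply: ge0_integral_image.
apply: ereal_inf_lbound; exists (distribution Q g); first by move=> B mB; split.
apply: (ge0_integral_image Q (distribution Q g) g
  (fun z => pnorm p (z.1 - z.2))) => //.
- by apply: measurable_dist; [exact: measurable_fst|exact: measurable_snd].
- by move=> z; exact: pnorm_ge0.
Qed.

End pnorm.

(** * The loss functions *)

Section loss.
Context {R : realType}.

Lemma star_functionE (x : R) : star_function x = scaled_loss 1 1 x.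
Proof. by apply/funext => u; rewrite /star_function /scaled_loss !mul1r. Qed.

Lemma measurable_scaled_loss (w1 w2 x : R) :
  measurable_fun setT (scaled_loss w1 w2 x).
Proof.
have mscale (w : R) (h : R * R -> R) :
    measurable_fun setT h -> measurable_fun setT (fun u => w * h u).
  by move=> mh; apply: measurable_funM.
apply: measurable_maxr; apply: mscale; apply: measurable_funB => //.
Qed.

Lemma measurable_hinge (w1 w2 x t : R) :
  measurable_fun setT (fun u => Num.max (scaled_loss w1 w2 x u + t) 0).
Proof.
apply: measurable_maxr => //; apply: measurable_funD => //.
exact: measurable_scaled_loss.
Qed.

Lemma hinge_ge0 (l t : R) : 0 <= Num.max (l + t) 0.
Proof. by rewrite le_max lexx orbT. Qed.

Lemma hinge_nonexpansive (p w x t : R) : 0 < p -> 0 <= w <= 1 ->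
  nonexpansive p (fun u => Num.max (scaled_loss w w x u + t) 0).
Proof.
move=> p0 /andP[w0 w1] u v; set dist := pnorm p (u - v).
have dist0 : 0 <= dist by exact: pnorm_ge0.
have contract (c : R) : `|c| <= dist -> w * c <= dist.
  move=> cd; rewrite (le_trans (ler_norm _)) // normrM ger0_norm //.
  by rewrite (le_trans _ cd) // ler_piMl.
have h1 : w * (u.1 - v.1) <= dist by apply: contract; exact: (le_fst_pnorm _ p0 (u - v)).
have h2 : w * (v.2 - u.2) <= dist.
  by apply: contract; rewrite distrC; exact: (le_snd_pnorm _ p0 (u - v)).
rewrite /scaled_loss.
have [a1 a2] : w * (u.1 - x) <= w * (v.1 - x) + dist /\
    w * (x - u.2) <= w * (x - v.2) + dist by split; lra.
rewrite ge_max; apply/andP; split; last by rewrite addr_ge0 ?hinge_ge0.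
move: a1 a2; move: (w * _) (w * _) (w * _) (w * _) => a a' b b' h3 h4.
rewrite /Order.max; case: (ltP b a) => ?; case: (ltP b' a') => ?;
  by do !case: ltP => ?; lra.
Qed.

End loss.

(** * CVaR and optimal values *)

Section cvar.
Context {R : realType}.
Implicit Types (P Q : probability (R * R)%type R).

(** The level [tau = - t] is a witness for the infimum. *)
Lemma cvar_le0 (eps t : R) P (l : R * R -> R) : 0 < eps ->
  (\int[P]_u (Num.max (l u + t)%R 0%R)%:E <= (eps * t)%:E)%E ->
  (cvar eps P l <= 0)%E.
Proof.
move=> eps0 hint; apply: ge_ereal_inf.
exists ((- t)%:E + 'E_P[fun u => Num.max (l u - - t)%R 0%R] * (eps^-1)%:E)%E.
  by exists (- t).
rewrite unlock opprK EFinN addeC sube_le0.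
rewrite -lee_pdivlMr ?invr_gt0 // invrK -EFinM mulrC.
exact: hint.
Qed.

Lemma optimal_value_bounds (S : set R) (x : R) :
  S `<=` star_domain (R := R) -> S x ->
  ((- 1)%:E <= optimal_value (-1) S <= (- x)%:E)%E.
Proof.
move=> Sdom Sx; apply/andP; split.
  apply: le_ereal_inf_tmp => _ [y /Sdom /andP[_ y1] <-].
  by rewrite lee_fin mulN1r lerN2.
by apply: ereal_inf_lbound; exists x => //; rewrite mulN1r.
Qed.

Lemma near_optimal_values (S T : set R) (x : R) :
  S `<=` star_domain (R := R) -> T `<=` star_domain (R := R) -> S x -> T x ->
  (`|optimal_value (-1) S - optimal_value (-1) T| <= (1 - x)%:E)%E.
Proof.
move=> Sdom Tdom Sx Tx.
have := optimal_value_bounds _ _ Sdom Sx; have := optimal_value_bounds _ _ Tdom Tx.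
case: (optimal_value _ _) => [b| |]; case: (optimal_value _ _) => [a| |];
  rewrite ?leye_eq ?leeNy_eq ?andbF //.
rewrite !lee_fin => /andP[? ?] /andP[? ?].
by rewrite ler_norml; apply/andP; split; lra.
Qed.

End cvar.

(** * Deterministic consequences for a two-point law *)

Section two_point_law.
Context {R : realType}.
Variables (p theta : R) (Phat P0 : probability (R * R)%type R).
Hypothesis p0 : 0 < p.
Let F := wasserstein_ball p theta Phat.
Hypothesis FP0 : F P0.

(** [P] and [P0] are each within [theta] of the centre, which explains the factor
2. Comparing with [P0] instead of the centre makes the true [rho] appear. *)
Lemma ball_integral P (f : R * R -> R) : F P ->
  measurable_fun setT f -> (forall x, 0 <= f x) -> nonexpansive p f ->
  (\int[P]_x (f x)%:E <= \int[P0]_x (f x)%:E + (theta + theta)%:E)%E.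
Proof.
move=> FP mf f0 fne.
have [le1 _] := wasserstein_integral p _ _ _ _ mf f0 fne FP.
have [_ le2] := wasserstein_integral p _ _ _ _ mf f0 fne FP0.
by rewrite (le_trans le1) // EFinD addeA leeD2r.
Qed.

Variables eps rho : R.
Hypothesis eps0 : 0 < eps.
Hypothesis P0_unsafe : P0 [set (1, 1)] = rho%:E.
Hypothesis P0_supp : P0 [set (1, 1); (-1, 1)] = 1%E.

Lemma ball_hinge_integral P (t : R) : 0 <= t <= 1 / 2 -> F P ->
  theta <= t * (eps / 2 - rho) ->
  (\int[P]_u (Num.max (scaled_loss (1 / 2) (1 / 2) (1 - 2 * t) u + t)%R 0%R)%:E
    <= (eps * t)%:E)%E.
Proof.
move=> t01 FP small.
pose f (u : R * R) : R :=
  Num.max (scaled_loss (1 / 2) (1 / 2) (1 - 2 * t) u + t) 0.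
have mf : measurable_fun setT f by exact: measurable_hinge.
have f0 u : 0 <= f u by exact: hinge_ge0.
have fne : nonexpansive p f by apply: hinge_nonexpansive => //; lra.
rewrite (le_trans (ball_integral P f FP mf f0 fne)) //.
have fsafe : f (-1, 1) = 0.
  rewrite /f /scaled_loss /=.
  by rewrite (max_idPr _) ?(max_idPr _); lra.
have funsafe : f (1, 1) = 2 * t.
  rewrite /f /scaled_loss /=.
  by rewrite (max_idPl _) ?(max_idPl _); lra.
rewrite (integral_two_atoms P0 f _ _ mf f0 P0_supp fsafe) P0_unsafe funsafe.
by rewrite -EFinM -EFinD lee_fin; lra.
Qed.

(** The factor in the smallness condition is what remains of
[2 t rho + 2 theta <= eps t] after division by 2. *)
Lemma near_one_feasible (t : R) : 0 < t <= 1 / 2 ->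
  theta <= t * (eps / 2 - rho) ->
  cvar_feasible F eps (1 / 2) (1 / 2) (1 - 2 * t) /\
  star_feasible F eps (1 - 2 * t).
Proof.
move=> /andP[t0 t1] small.
have dom : star_domain (1 - 2 * t) by rewrite /star_domain /=; lra.
have t01 : 0 <= t <= 1 / 2 by rewrite ltW.
split; split => //.
  apply: ge_ereal_sup => _ [P FP <-]; apply: (cvar_le0 _ t) => //.
  exact: ball_hinge_integral.
move=> P FP; set l := scaled_loss (1 / 2) (1 / 2) (1 - 2 * t).
have ml : measurable_fun setT l by exact: measurable_scaled_loss.
have violation : (P [set u | (0 <= l u)%R] <= eps%:E)%E.
  apply: (markov_hinge P l t) => //; exact: ball_hinge_integral.
have mbad : measurable [set u | 0 <= l u] by exact: measurable_ge0.
rewrite [X in P X](_ : _ = ~` [set u | 0 <= l u]).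
  by rewrite probability_setC // EFinB leeB.
apply/seteqP; split => u /=; rewrite /l /scaled_loss le_max.
  by move=> /andP[? ?]; apply/negP; rewrite negb_or -!ltNge; apply/andP; split; lra.
by move=> /negP; rewrite negb_or -!ltNge => /andP[? ?]; apply/andP; split; lra.
Qed.

Hypothesis theta0 : 0 <= theta.
Hypothesis Phat_supp : Phat [set (1, 1); (-1, 1)] = 1%E.
Hypothesis eps1 : eps < 1.

Let hinge (x : R) (u : R * R) : R := Num.max (star_function x u) 0.

Let measurable_star_hinge x : measurable_fun setT (hinge x).
Proof.
apply: measurable_maxr => //; rewrite star_functionE.
exact: measurable_scaled_loss.
Qed.

Let star_hinge_ge0 x u : 0 <= hinge x u.
Proof. by rewrite le_max lexx orbT. Qed.

Let star_hinge_nonexpansive x : nonexpansive p (hinge x).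
Proof.
have := @hinge_nonexpansive R p 1 x 0 p0.
by rewrite ler01 lexx -star_functionE; under eq_fun do rewrite addr0; exact.
Qed.

Lemma worst_case_hinge_at_one :
  (worst_case_hinge F (@star_function R) 1 <= theta%:E)%E.
Proof.
apply: ge_ereal_sup => _ [P FP <-]; rewrite unlock.
have [+ _] := wasserstein_integral p P Phat theta (hinge 1)
  (measurable_star_hinge 1) (star_hinge_ge0 1) (star_hinge_nonexpansive 1) FP.
rewrite (integral_two_atoms Phat (hinge 1) (1, 1) (-1, 1)) //.
- rewrite (_ : hinge 1 (1, 1) = 0) ?mul0e ?add0e //.
  by rewrite /hinge /star_function /=; rewrite subrr !maxxx.
- by rewrite /hinge /star_function /=; rewrite subrr !(max_idPr _); lra.
Qed.

(** The perturbed law moves only the unsafe atom, where the hinge has slope 1 in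
the first coordinate. Moving all points by [theta] along that axis would not
suffice: the displacement of the safe atom would be wasted. *)
Lemma worst_case_hinge_below_one (x : R) : 0 <= x < 1 ->
  (0 < Phat [set (1%R, 1%R)])%E ->
  (theta%:E < worst_case_hinge F (@star_function R) x)%E.
Proof.
move=> x01 rhohat0; set rhohat := fine (Phat [set (1, 1)]).
have rhohatE : Phat [set (1, 1)] = rhohat%:E.
  by rewrite fineK // fin_num_measure //; exact: measurable_point.
have r0 : 0 < rhohat by rewrite -lte_fin -rhohatE.
(* The displacement that spends the whole budget on mass rhohat. *)
pose c := theta / rhohat.
have c0 : 0 <= c by rewrite divr_ge0 // ltW.
pose s (u : R * R) : R * R := (u.1 + c * \1_[set (1, 1)] u, u.2).
have ms : measurable_fun setT s.
  apply: measurable_fun_pair => //; apply: measurable_funD => //.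
  apply: measurable_funM => //; apply: measurable_indic.
  exact: measurable_point.
have s_unsafe : s (1, 1) = (1 + c, 1) by rewrite /s indicE mem_set //= mulr1.
have s_safe : s (-1, 1) = (-1, 1).
  rewrite /s indicE memNset /= ?mulr0 ?addr0 //; move=> [] /eqP.
  by rewrite -subr_eq0 => /eqP; lra.
have [P [costP intP]] := image_law p Phat s ms.
have FP : F P.
  rewrite /F /wasserstein_ball /= (le_trans costP) //.
  rewrite (integral_two_atoms Phat (fun u => pnorm p (s u - u)) (1, 1) (-1, 1)) //.
  - rewrite s_unsafe rhohatE.
    rewrite (_ : _ - _ = (c, 0)); last by congr pair => /=; lra.
    rewrite pnorm_horizontal // ger0_norm // -EFinM lee_fin.
    by rewrite /c divfK // lt0r_neq0.
  - exact: measurable_dist.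
  - by move=> u; exact: pnorm_ge0.
  - rewrite s_safe subrr (_ : 0 = (0, 0)) // pnorm_horizontal //.
    exact: normr0.
apply: (@lt_le_trans _ _ 'E_P[hinge x]%E); last by apply: ereal_sup_ubound; exists P.
rewrite unlock (intP (hinge x)) //.
rewrite (integral_two_atoms Phat (hinge x \o s) (1, 1) (-1, 1)) //=.
- rewrite s_unsafe rhohatE -EFinM lte_fin.
  have -> : hinge x (1 + c, 1) = 1 + c - x.
    rewrite /hinge /star_function /=.
    by rewrite (max_idPl _) ?(max_idPl _); lra.
  have -> : (1 + c - x) * rhohat = c * rhohat + (1 - x) * rhohat by lra.
  by rewrite /c divfK ?lt0r_neq0 // ltrDl mulr_gt0 // subr_gt0; lra.
- exact: measurableT_comp.
- by rewrite s_safe /hinge /star_function /= !(max_idPr _); lra.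
Qed.

(** The hinge at [x = 0] is 1 at the unsafe atom and 0 at the safe one, hence
its integral against either law is the mass of the unsafe atom. Since [P0] lies
in the ball, [rho] exceeds the empirical mass by at most [theta]. *)
Lemma atom_gt0 : theta < rho -> (0 < Phat [set (1%R, 1%R)])%E.
Proof.
move=> small.
have [+ _] := wasserstein_integral p P0 Phat theta (hinge 0)
  (measurable_star_hinge 0) (star_hinge_ge0 0) (star_hinge_nonexpansive 0) FP0.
have unsafe : hinge 0 (1, 1) = 1.
  by rewrite /hinge /star_function /= !(max_idPl _); lra.
have safe : hinge 0 (-1, 1) = 0.
  by rewrite /hinge /star_function /= !(max_idPr _); lra.
have ? := measurable_star_hinge 0; have ? := star_hinge_ge0 0.
rewrite !(integral_two_atoms _ (hinge 0) (1, 1) (-1, 1)) // unsafe P0_unsafe !mul1e.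
have : (0 <= Phat [set (1%R, 1%R)])%E by exact: measure_ge0.
rewrite le_eqVlt => /predU1P[<-|//].
by rewrite add0e lee_fin leNgt small.
Qed.

Lemma alsox_infeasible_ball : theta < rho ->
  alsox_infeasible F eps (@star_domain R) (-1) (@star_function R).
Proof.
move=> /atom_gt0 rhohat0.
have below x : star_domain x ->
    (worst_case_hinge F (@star_function R) x <= theta%:E)%E -> x = 1.
  move=> /andP[x0 x1] hx; apply/eqP; rewrite eq_le x1 leNgt.
  apply/negP => xlt1; move: hx; apply/negP; rewrite -ltNge.
  by apply: worst_case_hinge_below_one => //; rewrite x0.
have one_dom delta : alsox_domain (@star_domain R) (-1) delta !=set0 ->
    alsox_domain (@star_domain R) (-1) delta 1.
  move=> [x [/andP[x0 x1] xd]]; split; first by rewrite /star_domain /= ler01 lexx.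
  by rewrite (le_trans _ xd) // !mulN1r lerN2.
split.
  exists (fun=> 1) => delta nonempty; split; first exact: one_dom.
  move=> y [ydom _]; rewrite leNgt; apply/negP => hlt.
  have y1 := below y ydom (ltW (lt_le_trans hlt worst_case_hinge_at_one)).
  by rewrite y1 ltxx in hlt.
move=> xs sel delta nonempty viol.
have [[xsdom _] min] := sel delta nonempty.
have xs1 : xs delta = 1.
  apply: below => //; apply: le_trans worst_case_hinge_at_one.
  exact/min/one_dom.
rewrite xs1 in viol.
have mS : measurable [set u : R * R | 0 <= star_function 1 u].
  by apply: measurable_ge0; rewrite star_functionE; exact: measurable_scaled_loss.
have : (1 <= eps%:E)%E.
  rewrite -P0_supp; apply: le_trans viol.
  apply: (@le_trans _ _ (P0 [set u | (0 <= star_function 1 u)%R])).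
    apply: le_measure; rewrite ?inE //; first exact: measurable_pair.
    by move=> u [] -> /=; rewrite /star_function /= subrr le_max lexx ?orbT.
  by apply: ereal_sup_ubound; exists P0.
by rewrite lee_fin leNgt eps1.
Qed.

End two_point_law.

(** * Sampling *)

Section sampling.
Context {R : realType} {d : measure_display} {Omega : measurableType d}.
Variable Pr : probability Omega R.

(** Finitely many sample sizes and an almost sure event do not affect a limit of
probabilities. The witnesses are emptied at the sample sizes for which the
inclusion fails, so that they are contained in [E' n] for every [n]. *)
Lemma with_probability_sub (E E' : nat -> set Omega) (G : set Omega) :
  measurable G -> Pr G = 1%E -> with_probability_going_to_1 Pr E ->
  (\forall n \near \oo, E n `&` G `<=` E' n) ->
  with_probability_going_to_1 Pr E'.
Proof.
move=> mG PG [A [mA AE PA]] EE'.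
pose A' n := if `[< A n `&` G `<=` E' n >] then A n `&` G else set0.
exists A'; split.
- by move=> n; rewrite /A'; case: ifP => // _; exact: measurableI.
- by move=> n; rewrite /A'; case: asboolP => // _ x [].
- apply: cvg_trans PA; apply: near_eq_cvg; near=> n.
  have EGn : E n `&` G `<=` E' n by (near: n; exact: EE').
  rewrite /A' asboolT; last by move=> x [/AE Ex Gx]; exact: EGn.
  rewrite (measureDI _ (mA n) mG) [X in (X + _)%E](_ : _ = 0%E) ?add0e //.
  apply/eqP; rewrite eq_le measure_ge0 andbT.
  have <- : Pr (~` G) = 0%E by rewrite probability_setC // PG subee.
  by apply: le_measure; rewrite ?inE; [exact: measurableD|exact: measurableC|move=> x []].
Unshelve. all: by end_near.
Qed.

Lemma almost_surely_all {d'} {T : measurableType d'} (X : nat -> {RV Pr >-> T})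
    (S : set T) :
  measurable S -> (forall i, Pr (X i @^-1` S) = 1%E) ->
  measurable (\bigcap_i (X i @^-1` S)) /\ Pr (\bigcap_i (X i @^-1` S)) = 1%E.
Proof.
move=> mS PS.
have mXS i : measurable (X i @^-1` S) by exact: measurable_funPTI.
have mcap : measurable (\bigcap_i (X i @^-1` S)) by exact: bigcapT_measurable.
split => //.
have null : Pr.-negligible (~` \bigcap_i (X i @^-1` S)).
  rewrite setC_bigcap; apply: negligible_bigcup => i.
  exists (~` (X i @^-1` S)); split => //; first exact: measurableC.
  by have := probability_setC Pr (mXS i); rewrite PS subee.
have PC : Pr (~` \bigcap_i (X i @^-1` S)) = 0%E.
  exact: measure_negligible (measurableC mcap) null.
by have := probability_setC Pr (measurableC mcap); rewrite setCK PC sube0.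
Qed.

Lemma empirical_full {d'} {T : measurableType d'} (x : nat -> T) (n : nat)
    (S : set T) : (forall i, S (x i)) -> empirical R x n S = 1%E.
Proof.
move=> Sx; rewrite /empirical /mscale /= /msum.
under eq_bigr do rewrite /= diracE mem_set //.
by rewrite sumEFin sumr_const card_ord -EFinM mulVf // pnatr_eq0.
Qed.

End sampling.

Theorem proposition16 (R : realType) (eps rho : R) (p : rat)
  (heps : 0 < eps < 1) (hrho : 0 < rho < eps / 2) (hp : 1 < p)
  (P0 : probability (R * R)%type R)
  (hP0_unsafe : P0 [set (1, 1)] = rho%:E)
  (hP0_safe : P0 [set (-1, 1)] = (1 - rho)%:E)
  (d : measure_display) (Omega : measurableType d) (Pr : probability Omega R)
  (xi : nat -> {RV Pr >-> (R * R)%type})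
  (hxi : iid_samples P0 xi)
  (theta : nat -> R)
  (htheta0 : forall N, 0 <= theta N)
  (htheta : theta N @[N --> \oo] --> (0 : R)) :
  let F (n : nat) (omega : Omega) : set (probability (R * R)%type R) :=
    wasserstein_ball (ratr p) (theta n.+1)
      (empirical R (fun i => xi i omega) n) in
  with_probability_going_to_1 Pr (fun n => [set omega | F n omega P0]) ->
  (forall eta : R, 0 < eta ->
    with_probability_going_to_1 Pr (fun n => [set omega |
      (`|cvar_value (F n omega) eps (1 / 2) (1 / 2)
         - star_value (F n omega) eps| <= eta%:E)%E])) /\
  with_probability_going_to_1 Pr (fun n => [set omega |
    alsox_infeasible (F n omega) eps (@star_domain R) (-1)
      (@star_function R)]).
Proof.
move=> F hF.
have [/andP[eps0 eps1] /andP[rho0 rho_lt]] := (heps, hrho).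
have p0 : 0 < ratr p :> R by rewrite ltr0q (lt_trans _ hp).
have P0_supp : P0 [set (1, 1); (-1, 1)] = 1%E.
  transitivity (P0 [set (1%R, 1%R)] + P0 [set (-1, 1)%R])%E; last first.
    by rewrite hP0_unsafe hP0_safe -EFinD addrC subrK.
  apply: measureU; [exact: measurable_point..|].
  apply/seteqP; split => // u [/= ->] [] /eqP.
  by rewrite -subr_eq0 => /eqP ?; lra.
pose S : set (R * R) := [set (1, 1); (-1, 1)].
have mS : measurable S := measurable_pair _ _.
have [mG PG] : measurable (\bigcap_i (xi i @^-1` S)) /\
    Pr (\bigcap_i (xi i @^-1` S)) = 1%E.
  apply: almost_surely_all => // i.
  by have := hxi.2 i S mS; rewrite P0_supp.
have theta_small (e : R) : 0 < e -> \forall n \near \oo, theta n.+1 < e.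
  move=> e0.
  move: htheta; rewrite -(cvg_shiftS theta) => /cvgrPdist_lt /(_ e e0).
  by apply: filterS => n; rewrite /= sub0r normrN ger0_norm /= ?htheta0.
split.
  move=> eta eta0; pose t := Num.min (eta / 2) (1 / 2).
  have t01 : 0 < t <= 1 / 2.
    by rewrite /t lt_min ge_min lexx orbT andbT; apply/andP; split; lra.
  have t_eta : 2 * t <= eta.
    have : t <= eta / 2 by rewrite ge_min lexx.
    by lra.
  apply: (with_probability_sub Pr _ _ _ mG PG hF).
  have e0 : 0 < t * (eps / 2 - rho).
    by apply: mulr_gt0; [case/andP: t01|lra].
  near=> n => omega [FP0 _] /=.
  have small : theta n.+1 < t * (eps / 2 - rho) by (near: n; exact: theta_small).
  have [] := near_one_feasible _ _ _ _ p0 FP0 eps rho eps0 hP0_unsafe P0_supp t t01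
    (ltW small).
  set x := 1 - 2 * t => cvar_x star_x.
  have := near_optimal_values _ _ x _ _ cvar_x star_x.
  move=> H; apply: le_trans (H _ _) _; [by move=> ? []..|].
  by rewrite lee_fin /x; lra.
apply: (with_probability_sub Pr _ _ _ mG PG hF).
near=> n => omega [FP0 samples] /=.
have small : theta n.+1 < rho by (near: n; exact: theta_small).
apply: (alsox_infeasible_ball _ _ _ _ p0 FP0 eps rho) => //.
apply: empirical_full => i; exact: samples.
Unshelve. all: by end_near.
Qed.
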